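(* Let $R$ be a ring, and let $\mathscr{P}$ be the collection of bi-infinite paths in $\mathscr{E}_R$. The itinerary map $\Sigma\colon\mathscr{P}\to R^{\mathbb{Z}}$ induces a one-to-one correspondence between $\mathrm{SL}_2(R)\backslash\mathscr{P}$ and $R^{\mathbb{Z}}$.
   Context: All rings are commutative with identity $1$. A pair $(a,b)\in R\times R$ is unimodular if $aR+bR=R$. $\mathscr{E}_R$ is the directed graph whose vertices are the unimodular pairs in $R\times R$, with a directed edge $(a,b)\to(c,d)$ if and only if $ad-bc=1$. A bi-infinite path in $\mathscr{E}_R$ is a sequence of vertices $(v_i)_{i\in\mathbb{Z}}$ with $v_{i-1}\to v_i$ a directed edge for all $i\in\mathbb{Z}$. $\mathrm{SL}_2(R)$ acts on vertices (regarded as column vectors) by left multiplication, and hence on $\mathscr{P}$. The itinerary of a bi-infinite path $\gamma$ with vertices $(a_i,b_i)$ is the bi-infinite sequence $\Sigma(\gamma)=(e_i)_{i\in\mathbb{Z}}$ in $R$ given by $e_i=a_{i-1}b_{i+1}-b_{i-1}a_{i+1}$. *)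

(* Defs.v *)
From HB Require Import structures.
From mathcomp Require Import all_boot all_order all_algebra.
From mathcomp Require Import boolp classical_sets.
From mathcomp Require Import ring.

Set Implicit Arguments.
Unset Strict Implicit.
Unset Printing Implicit Defensive.

Import GRing.Theory.
Local Open Scope classical_set_scope.
Local Open Scope ring_scope.

(* comPzRingType rather than comNzRingType: the zero ring is a ring. *)

Definition unimodular (R : comPzRingType) (p : R * R) : Prop :=
  [set p.1 * x.1 + p.2 * x.2 | x in [set: R * R]] = [set: R].

Record vertex (R : comPzRingType) := Vertex {
  vpair :> R * R;
  vertexP : unimodular vpair
}.

Definition edge (R : comPzRingType) (v w : vertex R) : Prop :=
  v.1 * w.2 - v.2 * w.1 = 1.

Record bipath (R : comPzRingType) := BiPath {
  bivert :> int -> vertex R;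
  bipathP : forall i : int, edge (bivert (i - 1)) (bivert i)
}.

Record SL2 (R : comPzRingType) := MkSL2 {
  SL2_mx :> 'M[R]_2;
  SL2P : \det SL2_mx = 1
}.

Section Action.
Variable R : comPzRingType.
Implicit Types (A : SL2 R) (p q : R * R).

Definition col_of_pair p : 'cV[R]_2 :=
  \col_(i < 2) (if i == ord0 then p.1 else p.2).

Definition pair_of_col (v : 'cV[R]_2) : R * R := (v ord0 ord0, v ord_max ord0).

Definition act_pair A p : R * R := pair_of_col (A *m col_of_pair p).

Lemma act_pairE A p : act_pair A p =
  (A ord0 ord0 * p.1 + A ord0 ord_max * p.2,
   A ord_max ord0 * p.1 + A ord_max ord_max * p.2).
Proof.
have e (i : 'I_2) : (A *m col_of_pair p) i ord0 =
    A i ord0 * p.1 + A i ord_max * p.2.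
  rewrite mxE big_ord_recr big_ord1 /= !mxE /=.
  by congr (A i _ * _ + _); apply/val_inj.
by rewrite /act_pair /pair_of_col !e.
Qed.

Lemma SL2_detE A :
  A ord0 ord0 * A ord_max ord_max - A ord0 ord_max * A ord_max ord0 = 1.
Proof.
have e1 : lift ord0 ord0 = ord_max :> 'I_2 by apply/val_inj.
have e2 : lift ord_max ord0 = ord0 :> 'I_2 by apply/val_inj.
have e3 : widen_ord (leqnSn 1) ord0 = ord0 :> 'I_2 by apply/val_inj.
rewrite -(SL2P A) (expand_det_row _ ord0) big_ord_recr big_ord1 /= e3.
rewrite /cofactor !det_mx11 !mxE /= e1 e2; ring.
Qed.

Lemma act_pair_det A p q :
  (act_pair A p).1 * (act_pair A q).2 - (act_pair A p).2 * (act_pair A q).1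
  = p.1 * q.2 - p.2 * q.1.
Proof.
rewrite !act_pairE /= -[RHS]mul1r -(SL2_detE A); ring.
Qed.

Lemma act_unimodular A p : unimodular p -> unimodular (act_pair A p).
Proof.
move=> up; apply/seteqP; split => // r _.
have : [set: R] r by [].
rewrite -up => -[[x y] _ /= <-].
(* p.1 x + p.2 y = det (p, (-y, x)), and the determinant is invariant. *)
exists ((act_pair A (- y, x)).2, - (act_pair A (- y, x)).1) => //=.
rewrite mulrN act_pair_det /=; ring.
Qed.

Definition act_vertex A (v : vertex R) : vertex R :=
  Vertex (act_unimodular A (vertexP v)).

Lemma act_edge A (v w : vertex R) :
  edge v w -> edge (act_vertex A v) (act_vertex A w).
Proof. by rewrite /edge /= act_pair_det. Qed.

Definition act_bipath A (g : bipath R) : bipath R :=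
  @BiPath R (fun i => act_vertex A (g i)) (fun i => act_edge A (bipathP g i)).

Definition SL2_orbit (g : bipath R) : set (bipath R) :=
  [set act_bipath A g | A in [set: SL2 R]].

(* The quotient SL_2(R)\P, as the type of SL_2(R)-orbits in P. *)
Definition bipath_quotient : Type :=
  {O : set (bipath R) | exists g : bipath R, O = SL2_orbit g}.

Definition orbit_class (g : bipath R) : bipath_quotient :=
  exist _ (SL2_orbit g) (ex_intro _ g erefl).

Definition itinerary (g : bipath R) : int -> R := fun i =>
  (g (i - 1)).1 * (g (i + 1)).2 - (g (i - 1)).2 * (g (i + 1)).1.

End Action.

(* Main.v *)
Require Import Defs.
From mathcomp Require Import all_boot all_order all_algebra.
From mathcomp Require Import boolp classical_sets.
From mathcomp Require Import ring.

(** Write [v_i] for the vertices of a bi-infinite path.  Consecutive vertices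
    form a basis of [R^2] of determinant one, and expanding [v_(i+1)] in the
    basis [(v_(i-1), v_i)] gives the recurrence
    [v_(i+1) = e_i v_i - v_(i-1)], where [e] is the itinerary
    ([bipath_recurrence]).  Thus the frames [(v_(i-1), v_i)] are the orbit of a
    single frame under the steps [(p, q) |-> (q, e_i q - p)].  These steps are
    invertible and preserve the determinant, so an itinerary together with one
    frame of determinant one determines a path, and every such choice occurs:
    hence every sequence is an itinerary ([itinerary_surj]), and two paths with
    the same itinerary differ only by the choice of the frame at [0].  Since
    [SL_2(R)] acts transitively on frames of determinant one
    ([SL2_transitive]) and preserves itineraries, the orbits of paths are
    exactly the fibres of the itinerary map ([SL2_orbitE]). *)

Set Implicit Arguments.
Unset Strict Implicit.
Unset Printing Implicit Defensive.

Import GRing.Theory.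
Local Open Scope classical_set_scope.
Local Open Scope ring_scope.

(** * Recursion over the integers *)

Section IntRecursion.
Variables (T : Type) (s s' : int -> T -> T).

Lemma int_rec_exists (x0 : T) : (forall i, cancel (s' i) (s i)) ->
  exists F : int -> T, F 0 = x0 /\ forall i, F (i + 1) = s i (F i).
Proof.
move=> s'K.
pose up := fix up n := if n is m.+1 then s m%:Z (up m) else x0.
(* [down n] is the value at [Negz n = - (n + 1)], hence the step back from [x0]. *)
pose down := fix down n :=
  s' (Negz n) (if n is m.+1 then down m else x0).
exists (fun i => match i with Posz n => up n | Negz n => down n end).
split=> // -[n|[|n]].
- by rewrite -PoszD addn1.
- by rewrite /= s'K.
have -> : Negz n.+1 + 1 = Negz n by rewrite !NegzE; ring.
by rewrite /= s'K.
Qed.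

Lemma int_rec_unique (F G : int -> T) : (forall i, injective (s i)) ->
  (forall i, F (i + 1) = s i (F i)) -> (forall i, G (i + 1) = s i (G i)) ->
  F 0 = G 0 -> F =1 G.
Proof.
move=> s_inj FS GS FG0; elim/int_rec => // n FGn.
  by rewrite -addn1 PoszD FS GS FGn.
apply: (s_inj (- n.+1%:Z)); rewrite -FS -GS.
by have -> : - n.+1%:Z + 1 = - n%:Z by rewrite -addn1 PoszD; ring.
Qed.

End IntRecursion.

Section Itinerary.
Variable R : comPzRingType.
Implicit Types (p q : R * R) (g h : bipath R) (A : SL2 R).

(** * Frames of determinant one *)

Definition cross p q : R := p.1 * q.2 - p.2 * q.1.

Lemma cross1_unimodularl p q : cross p q = 1 -> unimodular p.
Proof.
move=> pq; apply/seteqP; split=> // r _.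
exists (q.2 * r, - q.1 * r) => //=.
by rewrite -[RHS]mul1r -pq /cross; ring.
Qed.

Lemma cross1_unimodularr p q : cross p q = 1 -> unimodular q.
Proof.
move=> pq; apply: (@cross1_unimodularl q (- p.1, - p.2)).
by rewrite -pq /cross /=; ring.
Qed.

(** The matrix is [(p', q') (p, q)^-1], where the inverse of the frame
    [(p, q)] of determinant one is its adjugate. *)
Lemma SL2_transitive p q p' q' : cross p q = 1 -> cross p' q' = 1 ->
  exists A, act_pair A p = p' /\ act_pair A q = q'.
Proof.
case: p' q' => [a b] [c d] pq pq'.
pose row (x y : R) : R * R := (x * q.2 - y * p.2, y * p.1 - x * q.1).
pose M : 'M[R]_2 := \matrix_(i, j)
  let r := if i == ord0 then row a c else row b d in
  if j == ord0 then r.1 else r.2.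
have detM : \det M = 1.
  rewrite (expand_det_row _ ord0) big_ord_recr big_ord1 /=.
  rewrite /cofactor !det_mx11 !mxE /=.
  transitivity (cross p q * cross (a, b) (c, d)); last by rewrite pq pq' mulr1.
  by rewrite /cross /=; ring.
exists (MkSL2 detM); rewrite !act_pairE !mxE /=.
by split; congr pair; rewrite -[RHS]mulr1 -pq /cross; ring.
Qed.

(** * The recurrence satisfied by a path *)

Definition step (c : R) (f : (R * R) * (R * R)) : (R * R) * (R * R) :=
  (f.2, (c * f.2.1 - f.1.1, c * f.2.2 - f.1.2)).

Definition unstep (c : R) (f : (R * R) * (R * R)) : (R * R) * (R * R) :=
  ((c * f.1.1 - f.2.1, c * f.1.2 - f.2.2), f.1).

Lemma unstepK c : cancel (unstep c) (step c).
Proof. by move=> [[a b] [a' b']]; rewrite /step /=; do 2 congr pair; ring. Qed.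

Lemma stepK c : cancel (step c) (unstep c).
Proof. by move=> [[a b] [a' b']]; rewrite /unstep /=; do 2 congr pair; ring. Qed.

Lemma cross_step c f : cross (step c f).1 (step c f).2 = cross f.1 f.2.
Proof. by rewrite /cross /=; ring. Qed.

Definition frame g (i : int) : (R * R) * (R * R) :=
  (vpair (g (i - 1)), vpair (g i)).

(** Any [w] equals [cross w q * p + cross p w * q] when [cross p q = 1]; this
    is the case [p = v_(i-1)], [q = v_i], [w = v_(i+1)], for which
    [cross w q = -1] and [cross p w] is the itinerary. *)
Lemma bipath_recurrence g i :
  frame g (i + 1) = step (itinerary g i) (frame g i).
Proof.
have pq := bipathP g i; have qw := bipathP g (i + 1).
rewrite /edge addrK in pq qw.
rewrite /frame addrK /step /itinerary /=; congr pair.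
move: pq qw; case: (vpair (g (i - 1))) (vpair (g i)) (vpair (g (i + 1))).
move=> a b [c d] [x y] /= pq qw; congr pair.
  transitivity (x * (a * d - b * c)); first by rewrite pq mulr1.
  transitivity ((a * y - b * x) * c - (c * y - d * x) * a); first by ring.
  by rewrite qw mul1r.
transitivity (y * (a * d - b * c)); first by rewrite pq mulr1.
transitivity ((a * y - b * x) * d - (c * y - d * x) * b); first by ring.
by rewrite qw mul1r.
Qed.

Lemma bipath_ext g h : (forall i, vpair (g i) = vpair (h i)) -> g = h.
Proof.
case: g h => [g gP] [h hP] /= gh.
have {gh} gh : g = h.
  apply/funext => i; move: (gh i); case: (g i) (h i) => [p pP] [q qP] /= pq.
  by subst q; congr Vertex; apply: Prop_irrelevance.
by subst h; congr BiPath; apply: Prop_irrelevance.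
Qed.

Lemma bipath_eq g h :
  itinerary g = itinerary h -> frame g 0 = frame h 0 -> g = h.
Proof.
move=> gh gh0; apply: bipath_ext => i.
suff: frame g i = frame h i by case.
apply: (int_rec_unique (s := fun j => step (itinerary g j))
          (F := frame g) (G := frame h)) => // [j|j|j].
- exact: can_inj (stepK _).
- exact: bipath_recurrence.
- by rewrite gh; exact: bipath_recurrence.
Qed.

(** * Fibres and image of the itinerary map *)

Lemma itinerary_act A g : itinerary (act_bipath A g) = itinerary g.
Proof. by apply/funext => i; rewrite /itinerary /= act_pair_det. Qed.

(** Moving the frame of [g] at [0] to that of [h] by some [A] turns [g] into a
    path with the itinerary of [h] and one frame in common with it, so into
    [h].  Equality of orbits thereby becomes equality of itineraries. *)
Lemma SL2_orbitE g : SL2_orbit g = [set h | itinerary h = itinerary g].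
Proof.
apply/seteqP; split=> [_ [A _ <-]|h /= hg]; first exact: itinerary_act.
have [A [Ap Aq]] := SL2_transitive (bipathP g 0) (bipathP h 0).
exists A => //; apply: bipath_eq; first by rewrite itinerary_act hg.
by rewrite /frame /= Ap Aq.
Qed.

(** The frame at [0] may be any one of determinant one; the standard basis is
    used. *)
Lemma itinerary_surj (e : int -> R) : exists g, itinerary g = e.
Proof.
have [F [F0 FS]] := int_rec_exists (s := fun i => step (e i))
  ((1, 0), (0, 1)) (fun i => unstepK (e i)).
have F1 i : cross (F i).1 (F i).2 = 1.
  (* The determinant of the frames satisfies a recursion with trivial steps. *)
  apply: (int_rec_unique (s := fun _ => id)
            (F := fun j => cross (F j).1 (F j).2) (G := fun _ => 1)) => // [_ //|j|].
    by rewrite FS cross_step.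
  by rewrite F0 /cross /=; ring.
have Fl i : (F i).1 = (F (i - 1)).2 by rewrite -{1}[i](subrK 1) FS.
pose v i := Vertex (cross1_unimodularr (F1 i)).
have vP i : edge (v (i - 1)) (v i) by rewrite /edge /= -Fl; exact: F1.
exists (BiPath vP); apply/funext => i.
rewrite /itinerary /= -Fl FS /=.
by rewrite -[RHS]mulr1 -(F1 i) /cross; ring.
Qed.

End Itinerary.

Theorem theorem3p4 (R : comPzRingType) :
  exists f : bipath_quotient R -> (int -> R),
    (forall g : bipath R, f (orbit_class g) = itinerary g) /\ bijective f.
Proof.
pose f (O : bipath_quotient R) := itinerary (projT1 (cid (proj2_sig O))).
have fE g : f (orbit_class g) = itinerary g.
  rewrite /f; case: cid => h /= gh.
  have : SL2_orbit h h by rewrite SL2_orbitE.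
  by rewrite -gh SL2_orbitE.
exists f; split=> //.
exists (fun e => orbit_class (projT1 (cid (itinerary_surj e)))) => [[O [g Og]]|e].
  subst O; rewrite -/(orbit_class g) fE; case: cid => h /= hg.
  by apply: eq_exist; rewrite !SL2_orbitE hg.
by rewrite fE; case: cid.
Qed.
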